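(* Let $E = (E^0, E^1, r, s)$ be a finite directed graph, and let $A_E$ be its adjacency matrix. Then the Parry-Sullivan number $\mathcal{PS}(E) = \det(I - A_E)$ is equal to the number of vertex-disjoint sets of circuits of $E$ having even cardinality minus the number of vertex-disjoint sets of circuits of $E$ having odd cardinality. (The empty set of circuits is vertex-disjoint and of even cardinality.)
   Context: A (directed) graph $E$ is a 4-tuple $(E^0, E^1, r, s)$, where $E^0$ is a set of vertices, $E^1$ is a set of edges, and $r, s : E^1 \to E^0$ assign to each edge its range and source, respectively; loops and multiple edges are allowed. It is finite if $E^0$ and $E^1$ are finite. If $E$ has $n$ vertices, enumerated $1, \dots, n$, its adjacency matrix $A_E$ is the $n \times n$ integer matrix whose entry $(A_E)_{ij}$ is the number of edges from the $i$th vertex to the $j$th vertex. The Parry-Sullivan number is $\mathcal{PS}(E) = \det(I - A_E)$, with $I$ the $n \times n$ identity matrix. A (directed) cycle of $E$ is a sequence of edges $e_1 e_2 \cdots e_m$ with $m \geq 1$ such that $r(e_i) = s(e_{i+1})$ for $1 \leq i < m$, $r(e_m) = s(e_1)$, and $s(e_i) \neq s(e_j)$ whenever $i \neq j$. A (directed) circuit of $E$ is a finite set of edges $C \subseteq E^1$ whose elements can be arranged (each used exactly once) into a directed cycle; thus circuits are not distinguished by a starting vertex, but circuits using different parallel edges are different. A set $\mathcal{C}$ of circuits is vertex-disjoint if for any two distinct $C_1, C_2 \in \mathcal{C}$ the sets $\{ s(e) \mid e \in C_1 \}$ and $\{ s(e) \mid e \in C_2 \}$ are disjoint. The size (cardinality)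 of a set of circuits is the number of circuits in it. *)

(* Defs.v *)
From mathcomp Require Import all_boot all_order all_algebra.

Set Implicit Arguments.
Unset Strict Implicit.
Unset Printing Implicit Defensive.

Import GRing.Theory.
Local Open Scope ring_scope.

Record digraph := Digraph {
  vertex : finType;
  edge : finType;
  range : edge -> vertex;
  source : edge -> vertex
}.

(* The enumeration of the vertices is the parameter [v]; it is meant to be
   bijective. *)
Definition adjacency (E : digraph) n (v : 'I_n -> vertex E) : 'M[int]_n :=
  \matrix_(i < n, j < n)
    #|[set e : edge E | (source e == v i) && (range e == v j)]|%:Z.

Definition parry_sullivan (E : digraph) n (v : 'I_n -> vertex E) : int :=
  \det (1%:M - adjacency v).

(* [path.cycle] holds of the empty sequence, and relates the last edge back to
   the first one. *)
Definition dicycle (E : digraph) (c : seq (edge E)) : bool :=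
  [&& c != [::],
      cycle (fun e f : edge E => range e == source f) c
    & uniq [seq source e | e <- c]].

Definition circuit (E : digraph) (C : {set edge E}) : bool :=
  [exists c : #|C|.-tuple (edge E), perm_eq c (enum C) && dicycle c].

Definition circuit_set (E : digraph) (S : {set {set edge E}}) : bool :=
  [forall C in S, circuit C].

(* The condition ranges over distinct circuits, not over distinct vertex sets:
   two different circuits through the same vertices are not disjoint. *)
Definition vertex_disjoint (E : digraph) (S : {set {set edge E}}) : bool :=
  [forall C1 in S, forall C2 in S, (C1 != C2) ==>
     [disjoint [set source e | e in C1] & [set source e | e in C2]]].

(* Main.v *)
Require Import Defs.
From mathcomp Require Import all_boot all_order all_algebra.
From mathcomp Require Import perm.
Local Open Scope ring_scope.

Set Implicit Arguments.
Unset Strict Implicit.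
Unset Printing Implicit Defensive.
Import GRing.Theory.

(** Expand [det (I - A)] over permutations [s], and expand every entry
    [(i == s i) - A i (s i)] as a sum of signs: [1] for staying at [i], when
    [s i = i], and [-1] for each edge from [v i] to [v (s i)]
    ([det_selections]). The determinant becomes a signed sum over selections:
    pairs of a permutation [s] and a choice [f], at each index [i], of such an
    edge or of none.

    Along an orbit of [s], either no edge is chosen, and the orbit is a fixed
    point, or an edge is chosen at every index, and the chosen edges form a
    circuit. So a selection determines a vertex-disjoint set of circuits,
    [blocks s f]. This is a bijection from selections to vertex-disjoint sets
    of circuits ([blocks_valid], [blocks_inj], [blocks_surj]): each vertex met
    by the circuits has exactly one outgoing edge among them, and following it
    permutes these vertices.

    If there are [a] indices with a chosen edge, [b] without, and [k] circuits,
    then [n = a + b] and [s] has [k + b] orbits. The sign of [s] is therefore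
    [(-1) ^ (a + b + k + b) = (-1) ^ (a + k)], and multiplied by the weight
    [(-1) ^ a] of the chosen edges it gives [(-1) ^ k] ([selection_sign]). *)

(** * Orbits and circuits *)

Lemma porbit_fconnect (T : finType) (s : {perm T}) (x y : T) :
  (y \in porbit s x) = fconnect s x y.
Proof.
apply/porbitP/idP => [[i ->]|/iter_findex <-].
  by rewrite permX fconnect_iter.
by exists (findex s x y); rewrite permX.
Qed.

Lemma dicycle_source (E : digraph) (c : seq (edge E)) (e : edge E) :
  dicycle c -> e \in c -> exists2 e', e' \in c & range e' = source e.
Proof.
case/and3P=> _ cc _ ec; exists (prev c e); first by rewrite mem_prev.
by have /eqP := prev_cycle cc ec.
Qed.

Lemma uniq_map_inj_in (T1 T2 : eqType) (h : T1 -> T2) (t : seq T1) :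
  uniq (map h t) -> {in t &, injective h}.
Proof.
elim: t => //= a t IHt /andP[hat /IHt inj_h] x y /[!inE].
case/predU1P=> [->|xt] /predU1P[->|yt] // hxy; last exact: inj_h.
  by rewrite hxy map_f in hat.
by rewrite -hxy map_f in hat.
Qed.

(** The existence of a tuple enumerating [C] along a cycle amounts to the
    existence of a cyclic sequence with the same elements, because the sources
    of a cycle, hence its edges, are pairwise distinct. *)
Lemma circuitP (E : digraph) (C : {set edge E}) :
  reflect (exists2 c, dicycle c & C =i c) (circuit C).
Proof.
apply: (iffP existsP) => [[c /andP[pc dc]]|[c dc Cc]].
  by exists c => // e; rewrite (perm_mem pc) mem_enum.
have uc : uniq c by case/and3P: dc => _ _ /map_uniq.
have sz : size c == #|C| by rewrite (eq_card Cc) (card_uniqP uc).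
exists (Tuple sz); rewrite /= dc andbT.
by apply: uniq_perm => // [|e]; rewrite ?enum_uniq // mem_enum Cc.
Qed.

(** * Selections of edges *)

Section Selections.

Variables (E : digraph) (n : nat) (v : 'I_n -> vertex E).
Hypothesis v_bij : bijective v.

Implicit Types (s : 'S_n) (f : {ffun 'I_n -> option (edge E)}).
Implicit Types (O : {set 'I_n}) (S : {set {set edge E}}).

Let v_inj : injective v := bij_inj v_bij.

(** The terms in the expansion of the entry [(i, j)] of [I - A]: [None] is the
    term coming from [I], [Some e] the term of the edge [e] in [- A]. *)
Definition selectable (i j : 'I_n) (o : option (edge E)) : bool :=
  if o is Some e then (source e == v i) && (range e == v j) else i == j.

(** The sign of a term in the expansion of an entry of [I - A]. *)
Definition weight (o : option (edge E)) : int := if o is Some _ then -1 else 1.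

(** [f] chooses a term of the entry [(i, s i)] for every [i]. *)
Definition selection s f : bool :=
  f \in family (fun i => [pred o | selectable i (s i) o]).

(** The edges chosen at the indices of [O]. *)
Definition block f O : {set edge E} := [set e | Some e \in f @: O].

(** The sets of edges chosen along the orbits of [s]; the fixed points of [s]
    at which no edge is chosen all yield [set0], which is left out. *)
Definition blocks s f : {set {set edge E}} :=
  [set block f O | O in porbits s] :\ set0.

Lemma selectionP s f :
  reflect (forall i, selectable i (s i) (f i)) (selection s f).
Proof. by apply: (iffP familyP) => h i; have := h i; rewrite inE. Qed.

Lemma det_selections :
  parry_sullivan v =
    \sum_(p : 'S_n * {ffun 'I_n -> option (edge E)} | selection p.1 p.2)
      (-1) ^+ (odd_perm p.1) * \prod_i weight (p.2 i).
Proof.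
rewrite /parry_sullivan /determinant.
rewrite -(pair_big_dep xpredT selection
  (fun s f => (-1) ^+ (odd_perm s) * \prod_i weight (f i))) /=.
apply: eq_bigr => s _; rewrite -big_distrr /=; congr (_ * _).
rewrite -(bigA_distr_big_dep (fun i o => selectable i (s i) o)
  (fun i o => weight o)) /=.
apply: eq_bigr => i _; rewrite !mxE big_mkcond (bigD1 None) //=.
congr (_ + _); first by case: eqP.
rewrite (reindex_omap Some id) /=; last by case.
under eq_bigl do rewrite eqxx.
rewrite -big_mkcond /= sumr_const mulNrn natz; congr (- (_%:Z)).
by apply: eq_card => e; rewrite !inE.
Qed.

Lemma mem_block f O e :
  reflect (exists2 i, i \in O & f i = Some e) (e \in block f O).
Proof.
by rewrite inE; apply: (iffP imsetP) => [[i iO ->]|[i iO fi]]; exists i.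
Qed.

(** * The circuits of a selection *)

Section Circuits.

Variables (s : 'S_n) (f : {ffun 'I_n -> option (edge E)}).
Hypothesis sf : selection s f.

Lemma selected i e : f i = Some e -> source e = v i /\ range e = v (s i).
Proof.
by move/selectionP: sf => /(_ i) + fi; rewrite fi => /andP[/eqP ? /eqP].
Qed.

Lemma unselected i : f i = None -> s i = i.
Proof. by move/selectionP: sf => /(_ i) + fi; rewrite fi => /eqP. Qed.

Lemma unselected_porbit i : f i = None -> porbit s i = [set i].
Proof.
move/unselected => si; apply/setP => j; rewrite porbit_fconnect inE.
apply/idP/eqP => [/iter_findex <-|-> //].
by elim: findex => //= k ->.
Qed.

(** If no edge is chosen at some index, its orbit is a singleton; so an orbit
    with one chosen edge has a chosen edge at each of its indices. *)
Lemma selected_porbit i j : j \in porbit s i -> f i -> f j.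
Proof.
move=> ji fi; case fj: (f j) => [//|]; move: ji fi; rewrite porbit_sym.
by rewrite (unselected_porbit fj) inE => /eqP->; rewrite fj.
Qed.

Lemma block_eq0 i : (block f (porbit s i) == set0) = ~~ f i.
Proof.
case fi: (f i) => [e|]; last first.
  apply/eqP/setP => e; rewrite in_set0; apply/negbTE/negP => /mem_block[j].
  by rewrite (unselected_porbit fi) inE => /eqP->; rewrite fi.
by apply/set0Pn; exists e; apply/mem_block; exists i => //; apply: porbit_id.
Qed.

Lemma blocksP C :
  reflect (exists2 i, f i & C = block f (porbit s i)) (C \in blocks s f).
Proof.
rewrite in_setD1; apply: (iffP andP) => [[C0]|[i fi ->]].
  move=> /imsetP[_ /imsetP[i _ ->] CE].
  by exists i => //; move: C0; rewrite CE block_eq0 negbK.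
by rewrite block_eq0 fi !imset_f.
Qed.

(** A chosen edge determines the orbit at which it is chosen, by its source. *)
Lemma block_inj i j e :
  e \in block f (porbit s i) -> e \in block f (porbit s j) ->
  porbit s i = porbit s j.
Proof.
move=> /mem_block[k ki fk] /mem_block[l lj fl].
have /v_inj kl : v k = v l by rewrite -(selected fk).1 (selected fl).1.
by move: ki lj; rewrite -!eq_porbit_mem kl => /eqP<- /eqP<-.
Qed.

Lemma block_circuit i : f i -> circuit (block f (porbit s i)).
Proof.
case fi: (f i) => [e0|] // _; apply/circuitP.
(* [e0] is only a default value: an edge is chosen all along the orbit of [i]. *)
pose g j := odflt e0 (f j).
have fg j : j \in fingraph.orbit s i -> f j = Some (g j).
  rewrite -fconnect_orbit -porbit_fconnect => /selected_porbit.
  by rewrite fi /g => /(_ isT); case: (f j).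
have src j : j \in fingraph.orbit s i -> source (g j) = v j.
  by move/fg/selected => [].
exists [seq g j | j <- fingraph.orbit s i]; last first.
  move=> e; apply/mem_block/mapP => -[j ji]; last first.
    by move=> ->; exists j; rewrite ?fg // porbit_fconnect fconnect_orbit.
  move: ji; rewrite porbit_fconnect fconnect_orbit /g => ? fj.
  by exists j; rewrite ?fj.
apply/and3P; split.
- by rewrite -size_eq0 size_map size_orbit -lt0n order_gt0.
- rewrite cycle_map.
  apply: (sub_in_cycle _ (allss _) (cycle_orbit (@perm_inj _ s) i)) => j k.
  move=> ji ki /= /eqP sj.
  by rewrite (selected (fg _ ji)).2 src // sj.
- rewrite -map_comp.
  rewrite (@eq_in_map _ _ _ v _).1; first by rewrite map_inj_uniq ?orbit_uniq.
  by move=> j; apply: src.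
Qed.

Lemma blocks_valid : circuit_set (blocks s f) && vertex_disjoint (blocks s f).
Proof.
apply/andP; split.
  by apply/'forall_implyP => C /blocksP[i fi ->]; apply: block_circuit.
apply/'forall_implyP => C1 /blocksP[i fi ->].
apply/'forall_implyP => C2 /blocksP[j fj ->]; apply/implyP => ij.
rewrite -setI_eq0; apply/set0Pn => -[x /setIP[]].
move=> /imsetP[e ei ->] /imsetP[e' ej ee'].
move: (ei) (ej) => /mem_block[k _ fk] /mem_block[l _ fl].
move: ee'; rewrite (selected fk).1 (selected fl).1 => /v_inj kl.
move: fk; rewrite kl fl => -[ee]; rewrite ee in ej.
by move: ij; rewrite (block_inj ei ej) eqxx.
Qed.

Lemma mem_cover_blocks e :
  (e \in cover (blocks s f)) = [exists i, f i == Some e].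
Proof.
apply/bigcupP/existsP => [[C /blocksP[i _ ->] /mem_block[j _ fj]]|[i /eqP fi]].
  by exists j; apply/eqP.
exists (block f (porbit s i)).
  by apply/blocksP; exists i; rewrite ?fi.
by apply/mem_block; exists i; rewrite ?porbit_id.
Qed.

Lemma selection_sign :
  (-1) ^+ (odd_perm s) * \prod_i weight (f i) = (-1) ^+ #|blocks s f| :> int.
Proof.
have -> : \prod_i weight (f i) = (-1) ^+ #|[set i | isSome (f i)]|.
  rewrite -prodr_const [LHS](bigID (fun i => isSome (f i))) /=.
  rewrite [X in _ * X]big1 ?mulr1.
    by apply: eq_big => i; rewrite ?inE //; case: (f i).
  by move=> i; case: (f i).
(* The orbits with an empty block are the singletons [[set i]] with no edge
   chosen at [i]; the others are in bijection with the blocks. *)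
have porb : #|porbits s| = (#|blocks s f| + #|[set i | ~~ f i]|)%N.
  rewrite -(cardsID [set O | block f O == set0] (porbits s)) addnC.
  congr (_ + _)%N; last first.
    rewrite -(card_imset _ (@set1_inj 'I_n)); apply: eq_card => O.
    rewrite in_setI inE; apply/andP/imsetP => [[/imsetP[i _ ->]]|[i]].
      rewrite block_eq0 => fi; exists i; rewrite ?inE //.
      by rewrite unselected_porbit //; case: (f i) fi.
    rewrite inE => fi ->; have fi' : f i = None by case: (f i) fi.
    by rewrite -(unselected_porbit fi') block_eq0 fi imset_f.
  have <- : block f @: (porbits s :\: [set O | block f O == set0]) = blocks s f.
    apply/setP=> C; rewrite in_setD1.
    apply/imsetP/andP => [[O]|[C0 /imsetP[O Os CE]]].
      by rewrite in_setD inE => /andP[O0 Os] ->; rewrite O0 imset_f.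
    by exists O => //; rewrite in_setD inE Os -CE C0.
  apply/esym/card_in_imset => O1 O2; rewrite !in_setD !inE.
  move=> /andP[/set0Pn[e e1] /imsetP[i _ Oi]] /andP[_ /imsetP[j _ Oj]] eqb.
  have e2 : e \in block f O2 by rewrite -eqb.
  by subst O1 O2; apply: block_inj e1 e2.
have cn : n = (#|[set i | isSome (f i)]| + #|[set i | ~~ f i]|)%N.
  rewrite -[LHS]card_ord -(cardsC [set i | isSome (f i)]); congr (_ + _)%N.
  by apply: eq_card => i; rewrite !inE.
rewrite -[X in _ * X]signr_odd -[RHS]signr_odd -signr_addb.
rewrite /odd_perm porb card_ord [X in odd X (+) _]cn.
rewrite !oddD; congr (_ ^+ nat_of_bool _).
by do 3![case: (odd _)].
Qed.

End Circuits.

(** * Selections correspond to vertex-disjoint sets of circuits *)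

(** The set of all edges in the circuits determines [f], which in turn
    determines [s]. *)
Lemma blocks_inj s1 f1 s2 f2 : selection s1 f1 -> selection s2 f2 ->
  blocks s1 f1 = blocks s2 f2 -> (s1, f1) = (s2, f2).
Proof.
move=> sf1 sf2 eqb.
have sub s f s' f' i e : selection s f -> selection s' f' ->
    blocks s f = blocks s' f' -> f i = Some e -> f' i = Some e.
  move=> sf sf' eqb' fi.
  have : e \in cover (blocks s f).
    by rewrite mem_cover_blocks //; apply/existsP; exists i; apply/eqP.
  rewrite eqb' mem_cover_blocks // => /existsP[j /eqP fj].
  rewrite (_ : i = j) //; apply: v_inj.
  by rewrite -(selected sf fi).1 (selected sf' fj).1.
have ef : f1 = f2.
  apply/ffunP => i; case f1i: (f1 i) => [e|].
    by rewrite (sub _ _ _ _ _ _ sf1 sf2 eqb f1i).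
  case f2i: (f2 i) => [e|] //.
  by rewrite (sub _ _ _ _ _ _ sf2 sf1 (esym eqb) f2i) in f1i.
subst f2; congr (_, _); apply/permP => i; case fi: (f1 i) => [e|].
  by apply: v_inj; rewrite -(selected sf1 fi).2 (selected sf2 fi).2.
by rewrite (unselected sf1 fi) (unselected sf2 fi).
Qed.

(** [f] picks the edge of [cover S] leaving each vertex, if any, and [s] follows
    it. *)
Lemma blocks_surj S : circuit_set S -> vertex_disjoint S ->
  exists s f, selection s f /\ blocks s f = S.
Proof.
move=> /'forall_implyP cS /'forall_implyP dS.
have [u vK uK] := v_bij.
have same C1 C2 e1 e2 : C1 \in S -> C2 \in S -> e1 \in C1 -> e2 \in C2 ->
    source e1 = source e2 -> e1 = e2.
  move=> S1 S2 eC1 eC2 ee.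
  have C12 : C1 = C2.
    apply/eqP/negPn/negP => C12.
    have /'forall_implyP/(_ _ S2)/implyP/(_ C12) := dS _ S1.
    move=> /disjointFr /(_ (imset_f _ eC1)).
    by rewrite ee imset_f.
  subst C2; have /circuitP[c /and3P[_ _ uc] Cc] := cS _ S1.
  by apply: (uniq_map_inj_in uc) => //; rewrite -Cc.
(* By the previous claim, at most one edge can be picked at each index. *)
pose f := [ffun i => [pick e in cover S | source e == v i]].
have f_some C e : C \in S -> e \in C -> f (u (source e)) = Some e.
  move=> CS eC; rewrite ffunE; case: pickP => [e'|/(_ e)].
    rewrite uK => /andP[/bigcupP[C' CS' eC'] /eqP se].
    by congr Some; apply: (same C' C).
  by rewrite uK eqxx andbT => /negP[]; apply/bigcupP; exists C.
have fP i e : f i = Some e -> source e = v i /\ exists2 C, C \in S & e \in C.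
  rewrite ffunE; case: pickP => // e' /andP[/bigcupP[C CS eC] /eqP se] [<-].
  by split=> //; exists C.
pose g i := if f i is Some e then u (range e) else i.
(* On a finite type, surjectivity is enough for [g] to be a permutation. It
   holds since an edge of a circuit has a predecessor in this circuit. *)
have g_surj j : exists i, g i = j.
  case fj: (f j) => [e|]; last first.
    by exists j; rewrite /g fj.
  have [se [C CS eC]] := fP _ _ fj.
  have /circuitP[c dc Cc] := cS _ CS.
  rewrite Cc in eC; have [e' e'c re'] := dicycle_source dc eC.
  exists (u (source e')); rewrite /g (f_some C) ?Cc //.
  by rewrite re' se vK.
have [h hK] := fin_all_exists g_surj.
have g_inj : injective g := can_inj (canF_sym hK).
pose s := perm g_inj.
have sf : selection s f.
  apply/selectionP => i; rewrite permE /g /selectable.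
  by case fi: (f i) => [e|] //; rewrite (fP _ _ fi).1 uK !eqxx.
(* The sources of the edges of [C], in cyclic order, form a cycle of [s]. *)
have blockE C e : C \in S -> e \in C -> block f (porbit s (u (source e))) = C.
  move=> CS eC; have /circuitP[c dc Cc] := cS _ CS.
  have porb j :
      (j \in porbit s (u (source e))) = (j \in [seq u (source e') | e' <- c]).
    have [_ cc _] := and3P dc.
    rewrite porbit_fconnect; apply: fconnect_cycle; last first.
      by apply: map_f; rewrite -Cc.
    rewrite cycle_map.
    apply: (sub_in_cycle _ (allss _) cc) => e1 e2 c1 c2 /= /eqP r12.
    by rewrite permE /g (f_some C) ?Cc // r12.
  apply/setP => e'; apply/mem_block/idP => [[j]|eC'].
    rewrite porb => /mapP[e1 c1 ->]; rewrite -Cc in c1.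
    by rewrite (f_some C) // => -[<-].
  exists (u (source e')); last exact: f_some eC'.
  by rewrite porb; apply/mapP; exists e'; rewrite -?Cc.
exists s, f; split=> //; apply/setP => C; apply/(blocksP sf)/idP => [[i]|CS].
  case fi: (f i) => [e|] // _ ->; have [se [C' CS eC]] := fP _ _ fi.
  by rewrite -[i]vK -se (blockE C').
have /circuitP[c /and3P[c0 _ _] Cc] := cS _ CS.
case: c c0 Cc => // e c _ Cc; have eC : e \in C by rewrite Cc mem_head.
by exists (u (source e)); rewrite ?(f_some C) ?(blockE C).
Qed.

Lemma parry_sullivan_sum :
  parry_sullivan v =
    \sum_(S : {set {set edge E}} | circuit_set S && vertex_disjoint S)
      (-1) ^+ #|S|.
Proof.
rewrite det_selections.
pose P := [set p : 'S_n * {ffun 'I_n -> option (edge E)} | selection p.1 p.2].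
transitivity (\sum_(p in P) (-1) ^+ #|blocks p.1 p.2| : int).
  apply: eq_big => [[s f]|[s f] sf]; first by rewrite inE.
  exact: selection_sign.
rewrite -(big_imset (fun S : {set {set edge E}} => (-1) ^+ #|S| : int)
  (h := fun p => blocks p.1 p.2)) /=; last first.
  by move=> [s1 f1] [s2 f2]; rewrite !inE; apply: blocks_inj.
apply: eq_bigl => S; apply/imsetP/andP => [[[s f]]|[cS dS]].
  by rewrite inE /= => sf ->; apply/andP; apply: blocks_valid.
by have [s [f [sf <-]]] := blocks_surj cS dS; exists (s, f); rewrite ?inE.
Qed.

End Selections.

Theorem theorem6 (E : digraph) (n : nat) (v : 'I_n -> vertex E)
    (v_bij : bijective v) :
  parry_sullivan v =
    #|[set S : {set {set edge E}} |
        [&& circuit_set S, vertex_disjoint S & ~~ odd #|S|]]|%:Z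
    - #|[set S : {set {set edge E}} |
        [&& circuit_set S, vertex_disjoint S & odd #|S|]]|%:Z.
Proof.
rewrite parry_sullivan_sum //.
rewrite (bigID (fun S : {set {set edge E}} => odd #|S|)) /= addrC -!sum1_card.
rewrite !(big_morph Posz PoszD (erefl _)) -sumrN.
congr (_ + _); apply: eq_big => [S|S /andP[_ oS]]; rewrite ?inE ?andbA //.
  by rewrite -signr_odd (negbTE oS).
by rewrite -signr_odd oS.
Qed.
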